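(* For every morphism $p\colon E\to B$ of nominal sets, the dependent separated product $\boxtimes_p\colon\mathbf{Nom}/E\to\mathbf{Nom}/B$ is right adjoint to the separated pullback functor $\nabla_p\colon\mathbf{Nom}/B\to\mathbf{Nom}/E$.
   Context: Fix a countably infinite set $\mathbb{A}$ of atoms, and let $\mathrm{Perm}(\mathbb{A})$ be the group of finite permutations of $\mathbb{A}$. A nominal set is a set $X$ with an action of $\mathrm{Perm}(\mathbb{A})$ such that every $x\in X$ has a finite support, i.e. a finite $S\subseteq\mathbb{A}$ such that every $\pi\in\mathrm{Perm}(\mathbb{A})$ fixing each element of $S$ satisfies $\pi\cdot x=x$; $\mathrm{supp}(x)$ denotes the least finite support. Morphisms of $\mathbf{Nom}$ are equivariant maps. Separated pullback: for $f\colon A\to X$ and $g\colon B\to X$ in $\mathbf{Nom}$, $$A*_X B=\{(a,b)\in A\times B : f(a)=g(b)=x,\ \mathrm{supp}(a)\cap\mathrm{supp}(b)=\mathrm{supp}(x)\},$$ with componentwise action. For $p\colon E\to B$, $\nabla_p\colon\mathbf{Nom}/B\to\mathbf{Nom}/E$ sends $g\colon X\to B$ to the projection $E*_B X\to E$, and a morphism $u$ over $B$ to $(e,x)\mapsto(e,u(x))$. Dependent separated product: for $p\colon E\to B$ and $f\colon A\to E$ in $\mathbf{Nom}$, with $E_b=p^{-1}(b)$, $\boxtimes_p(f)$ is the set of pairs $(b,s_b)$ where $b\in B$ and $s_b\colon E_b\rightharpoonup A$ is a partial section of $f$ (a partial function with $f(s_b(e))=e$ for all $e\in\mathrm{dom}\,s_b$),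 equipped with the action $\pi\star(b,s_b)=(\pi b,\pi*s_b)$, where $\pi*s_b$ is the partial section over $E_{\pi b}$ with domain $\pi(\mathrm{dom}\,s_b)$ given by $(\pi*s_b)(e)=\pi(s_b(\pi^{-1}e))$, such that simultaneously: (1) $(b,s_b)$ has finite support with respect to $\star$; (2) $\mathrm{dom}\,s_b=\{e\in E_b : \mathrm{supp}(e)\cap\mathrm{supp}(b,s_b)=\mathrm{supp}(b)\}$; (3) $\mathrm{supp}(b,s_b)\setminus\mathrm{supp}(b)=\bigcup_{e\in\mathrm{dom}\,s_b}\bigl(\mathrm{supp}(s_b(e))\setminus\mathrm{supp}(e)\bigr)$. It is regarded as an object of $\mathbf{Nom}/B$ via the equivariant projection $(b,s_b)\mapsto b$. *)

(* Defs.v *)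
From HB Require Import structures.
From mathcomp Require Import all_boot all_classical.

Set Implicit Arguments.
Unset Strict Implicit.
Unset Printing Implicit Defensive.

Local Open Scope classical_set_scope.
Local Open Scope group_scope.

Record category := Category {
  Ob :> Type;
  Hom : Ob -> Ob -> Type;
  idm : forall X, Hom X X;
  comp : forall X Y Z, Hom Y Z -> Hom X Y -> Hom X Z;
  comp_idl : forall X Y (u : Hom X Y), comp (idm Y) u = u;
  comp_idr : forall X Y (u : Hom X Y), comp u (idm X) = u;
  compA : forall X Y Z T (w : Hom Z T) (v : Hom Y Z) (u : Hom X Y),
    comp w (comp v u) = comp (comp w v) u }.
Arguments Hom {_} _ _.
Arguments idm {_} _.
Arguments comp {_ _ _ _} _ _.

Record functor (C D : category) := Functor {
  fob :> C -> D;
  fhom : forall X Y : C, Hom X Y -> Hom (fob X) (fob Y);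
  fhom_id : forall X, fhom (idm X) = idm (fob X);
  fhom_comp : forall X Y Z (v : Hom Y Z) (u : Hom X Y),
    fhom (comp v u) = comp (fhom v) (fhom u) }.
Arguments fhom {_ _} _ {_ _} _.

Definition right_adjoint (C D : category) (G : functor D C) (F : functor C D) :
    Prop :=
  exists phi : forall (X : C) (Y : D), Hom (F X) Y -> Hom X (G Y),
    (forall X Y, bijective (phi X Y)) /\
    (forall (X X' : C) (Y Y' : D) (u : Hom X' X) (v : Hom Y Y')
       (h : Hom (F X) Y),
       phi X' Y' (comp v (comp h (fhom F u)))
       = comp (fhom G v) (comp (phi X Y h) u)).

Section Slice.
Variables (C : category) (B : C).

Record sliceOb := SliceOb { dom_of : C; arr :> Hom dom_of B }.

Record sliceHom (g g' : sliceOb) := SliceHom {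
  shom :> Hom (dom_of g) (dom_of g');
  shomE : comp (arr g') shom = arr g }.

Lemma sliceHom_inj (g g' : sliceOb) (u v : sliceHom g g') :
  shom u = shom v -> u = v.
Proof.
by case: u v => [u uE] [v vE] /= uv; subst v; congr SliceHom; exact: Prop_irrelevance.
Qed.

Lemma slice_id_subproof (g : sliceOb) : comp (arr g) (idm _) = arr g.
Proof. exact: comp_idr. Qed.

Lemma slice_comp_subproof (g g' g'' : sliceOb) (v : sliceHom g' g'')
  (u : sliceHom g g') : comp (arr g'') (comp (shom v) (shom u)) = arr g.
Proof. by rewrite compA !shomE. Qed.

Definition slice : category.
Proof.
refine (@Category sliceOb sliceHom
  (fun g => SliceHom (slice_id_subproof g))
  (fun _ _ _ v u => SliceHom (slice_comp_subproof v u)) _ _ _).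
- by move=> X Y u; apply: sliceHom_inj; exact: comp_idl.
- by move=> X Y u; apply: sliceHom_inj; exact: comp_idr.
- by move=> X Y Z T w v u; apply: sliceHom_inj; exact: compA.
Defined.
End Slice.

Record finPerm (At : Type) := FinPerm {
  fp_fun :> At -> At;
  fp_bij : bijective fp_fun;
  fp_fin : finite_set [set a | fp_fun a <> a] }.

Bind Scope group_scope with finPerm.

Section FinPermGroup.
Variable At : Type.
Implicit Types pi sg : finPerm At.

Lemma finPermP pi sg : pi =1 sg -> pi = sg.
Proof.
case: pi sg => [f fb ff] [g gb gf] /= /funext fg; subst g.
by congr FinPerm; exact: Prop_irrelevance.
Qed.

Lemma fp_one_fin : finite_set [set a : At | id a <> a].
Proof. by rewrite (_ : mkset _ = set0) // -subset0 => a /=. Qed.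

Definition fp_one : finPerm At := FinPerm (Bijective (frefl id) (frefl id)) fp_one_fin.

Lemma fp_mul_fin pi sg : finite_set [set a | (pi \o sg) a <> a].
Proof.
apply: sub_finite_set (_ : _ `<=` [set a | sg a <> a] `|` [set a | pi a <> a]) _.
  move=> a /= h; case: (pselect (sg a = a)) => [e|]; last by left.
  by right; move: h; rewrite e.
by rewrite finite_setU; split; exact: fp_fin.
Qed.

(* Composition of functions: (pi * sg) a = pi (sg a). *)
Definition fp_mul pi sg : finPerm At :=
  FinPerm (bij_comp (fp_bij pi) (fp_bij sg)) (fp_mul_fin pi sg).

Lemma fp_inv_ex pi : exists sg : finPerm At, cancel pi sg /\ cancel sg pi.
Proof.
have [g fK gK] := fp_bij pi.
suff gf : finite_set [set a | g a <> a].
  by exists (FinPerm (Bijective gK fK) gf).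
apply: sub_finite_set (fp_fin pi) => a /= + e; apply.
by rewrite -{1}e fK.
Qed.

Definition fp_inv pi : finPerm At := sval (cid (fp_inv_ex pi)).

Lemma fp_invK pi : cancel pi (fp_inv pi).
Proof. exact: (svalP (cid (fp_inv_ex pi))).1. Qed.
Lemma fp_Kinv pi : cancel (fp_inv pi) pi.
Proof. exact: (svalP (cid (fp_inv_ex pi))).2. Qed.

HB.instance Definition _ := gen_eqMixin (finPerm At).
HB.instance Definition _ := gen_choiceMixin (finPerm At).

Lemma fp_mulA : associative fp_mul. Proof. by move=> f g h; exact: finPermP. Qed.
Lemma fp_mul1 : left_id fp_one fp_mul. Proof. by move=> f; exact: finPermP. Qed.
Lemma fp_mulr1 : right_id fp_one fp_mul. Proof. by move=> f; exact: finPermP. Qed.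
Lemma fp_mulV : left_inverse fp_one fp_inv fp_mul.
Proof. by move=> f; apply: finPermP => a /=; exact: fp_invK. Qed.
Lemma fp_mulrV : right_inverse fp_one fp_inv fp_mul.
Proof. by move=> f; apply: finPermP => a /=; exact: fp_Kinv. Qed.

HB.instance Definition _ := isGroup.Build (finPerm At)
  fp_mulA fp_mul1 fp_mulr1 fp_mulV fp_mulrV.
End FinPermGroup.

Section FinPermTheory.
Variable At : countType.
Implicit Types (pi sg : finPerm At) (S T : set At).

Lemma fpV pi : pi^-1%g = fp_inv pi :> (At -> At). Proof. by []. Qed.
Lemma fpK pi : cancel pi (pi^-1)%g. Proof. exact: fp_invK. Qed.
Lemma fpVK pi : cancel (pi^-1)%g pi. Proof. exact: fp_Kinv. Qed.
Lemma fp_inj pi : injective pi. Proof. exact: can_inj (fpK pi). Qed.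
Lemma fpM pi sg a : (pi * sg) a = pi (sg a). Proof. by []. Qed.
Lemma fp1 a : (1 : finPerm At) a = a. Proof. by []. Qed.

Lemma image_fpI pi S T :
  pi @` (S `&` T) = (pi @` S) `&` (pi @` T).
Proof.
apply/seteqP; split=> [_ [a [Sa Ta] <-]|_ [[a Sa <-] [b Tb /fp_inj ba]]].
  by split; exists a.
by exists a => //; split=> //; rewrite -ba.
Qed.

Definition fixes pi S := forall a, S a -> pi a = a.

Lemma fixesV pi S : fixes pi S -> fixes pi^-1 S.
Proof. by move=> h a /h {1}<-; rewrite fpK. Qed.

Lemma fixesM pi sg S : fixes pi S -> fixes sg S -> fixes (pi * sg) S.
Proof. by move=> h k a Sa; rewrite fpM k ?h. Qed.

Definition swap_fun (a b c : At) := if c == a then b else if c == b then a else c.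

Lemma swap_funK a b : involutive (swap_fun a b).
Proof.
move=> c; rewrite /swap_fun; have [->|ca] := eqVneq c a.
  by rewrite eqxx; case: eqVneq.
have [->|cb] := eqVneq c b; first by rewrite eqxx.
by rewrite (negPf ca) (negPf cb).
Qed.

Lemma swap_fin a b : finite_set [set c | swap_fun a b c <> c].
Proof.
apply: sub_finite_set (finite_set2 a b) => c /=; rewrite /swap_fun.
by case: eqVneq => [->|_]; [left|case: eqVneq => [->|//]; right].
Qed.

Definition swap a b : finPerm At :=
  FinPerm (inv_bij (swap_funK a b)) (swap_fin a b).

Lemma swapL a b : swap a b a = b.
Proof. by rewrite /= /swap_fun eqxx. Qed.
Lemma swapR a b : swap a b b = a.
Proof. by rewrite /= /swap_fun eqxx; case: eqVneq. Qed.
Lemma swapD a b c : c <> a -> c <> b -> swap a b c = c.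
Proof. by move=> /eqP/negPf ca /eqP/negPf cb; rewrite /= /swap_fun ca cb. Qed.

Lemma finPerm_extend (s : seq At) (h : At -> At) :
  {in s &, injective h} -> exists pi, forall a, a \in s -> pi a = h a.
Proof.
elim: s => [|a s IH] hinj; first by exists 1.
have [|pi piE] := IH.
  by move=> x y xs ys; apply: hinj; rewrite inE ?xs ?ys orbT.
case: (pselect (a \in s)) => [as_|as_].
  by exists pi => c; rewrite inE => /predU1P[->|]; exact: piE.
exists (swap (pi a) (h a) * pi) => c; rewrite inE fpM => /predU1P[->|cs].
  exact: swapL.
rewrite swapD; first exact: piE.
  by move=> /fp_inj ca; apply: as_; rewrite -ca.
rewrite piE// => /hinj ca; apply: as_; rewrite -ca// !inE ?eqxx// cs orbT//.
Qed.

Hypothesis At_inf : infinite_set [set: At].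

Lemma fresh S : finite_set S -> exists c, ~ S c.
Proof.
by move=> Sf; have [c [_ Sc]] := infinite_setN0 (infinite_setD At_inf Sf); exists c.
Qed.

Lemma finPerm_rename S T (s : seq At) : finite_set S -> finite_set T ->
  exists pi, fixes pi S /\ forall c, c \in s -> ~ S c -> ~ T (pi c).
Proof.
move=> Sf Tf; elim: s => [|a s [pi [piS piT]]]; first by exists 1.
case: (pselect (S a)) => [Sa|nSa].
  by exists pi; split=> // c; rewrite inE => /predU1P[->//|]; exact: piT.
case: (@fresh (S `|` (T `|` [set pi c | c in [set` s]]))).
  by rewrite !finite_setU; do !split=> //; exact: finite_image.
move=> e eP; exists (swap (pi a) e * pi); split=> [x Sx|c].
  rewrite fpM (piS x)// swapD// => xe; last by apply: eP; left; rewrite -xe.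
  by apply: nSa; rewrite -(fp_inj (etrans (piS _ Sx) xe)).
rewrite inE fpM => /predU1P[->|cs] nSc.
  by rewrite swapL => Te; apply: eP; right; left.
case: (pselect (c = a)) => [->|ca].
  by rewrite swapL => Te; apply: eP; right; left.
rewrite swapD; [exact: piT|by move/fp_inj|].
by move=> pe; apply: eP; right; right; exists c.
Qed.
End FinPermTheory.

Record permSet (At : countType) := PermSet {
  ps_car :> Type;
  act : finPerm At -> ps_car -> ps_car;
  act1 : forall x, act 1 x = x;
  actM : forall pi sg x, act (pi * sg) x = act pi (act sg x) }.
Arguments act {_ _} _ _.

Definition supports (At : countType) (X : permSet At) (S : set At) (x : X) :=
  forall pi : finPerm At, (forall a, S a -> pi a = a) -> act pi x = x.

Definition finitely_supported (At : countType) (X : permSet At) (x : X) :=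
  exists2 S : set At, finite_set S & supports S x.

(* The intersection of all finite supports; lemma [supp_least] below shows that
   it is the least finite support of every finitely supported element. *)
Definition supp (At : countType) (X : permSet At) (x : X) : set At :=
  \bigcap_(S in [set S | finite_set S /\ supports S x]) S.

Section SuppTheory.
Variables (At : countType) (X : permSet At).
Implicit Types (pi sg : finPerm At) (x : X) (S : set At).

Lemma actK pi : cancel (act pi : X -> X) (act pi^-1).
Proof. by move=> x; rewrite -actM mulVg act1. Qed.
Lemma actVK pi : cancel (act pi^-1 : X -> X) (act pi).
Proof. by move=> x; rewrite -actM mulgV act1. Qed.
Lemma act_inj pi : injective (act pi : X -> X).
Proof. exact: can_inj (actK pi). Qed.

Lemma supp_sub x S : finite_set S -> supports S x -> supp x `<=` S.
Proof. by move=> Sf Sx a; apply. Qed.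

Lemma supports_act pi x S : supports S x -> supports (pi @` S) (act pi x).
Proof.
move=> Sx sg sgS; apply: (act_inj (pi := pi^-1)).
rewrite actK -!actM.
apply: Sx => a Sa; rewrite !fpM sgS ?fpK//; by exists a.
Qed.

Lemma supp_act_sub pi x : pi @` supp x `<=` supp (act pi x).
Proof.
move=> _ [a xa <-] S [Sf Sx].
have [c Sc <-] : ((pi^-1)%g @` S) a.
  apply: xa; split; first exact: finite_image.
  by have := @supports_act (pi^-1) _ _ Sx; rewrite actK.
by rewrite fpVK.
Qed.

Lemma supp_act pi x : supp (act pi x) = pi @` supp x.
Proof.
apply/seteqP; split; last exact: supp_act_sub.
move=> a xa; exists ((pi^-1)%g a); last exact: fpVK.
by rewrite -[x in supp x](actK pi); apply: supp_act_sub; exists a.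
Qed.

Lemma finitely_supported_act pi x :
  finitely_supported x -> finitely_supported (act pi x).
Proof.
by case=> S Sf Sx; exists (pi @` S); [exact: finite_image|exact: supports_act].
Qed.

Lemma supp_finite x : finitely_supported x -> finite_set (supp x).
Proof. by case=> S Sf Sx; apply: sub_finite_set (supp_sub Sf Sx) Sf. Qed.

Hypothesis At_inf : infinite_set [set: At].

Lemma supports_setD1 x S T : finite_set S -> finite_set T ->
  supports S x -> supports T x -> forall a, ~ T a -> supports (S `\ a) x.
Proof.
move=> Sf Tf Sx Tx a nTa pi piS.
case: (fresh At_inf (S := S `|` T `|` [set c | pi c <> c])) => [|c cP].
  by rewrite !finite_setU; do !split=> //; exact: fp_fin.
have nSc : ~ S c by move=> ?; apply: cP; left; left.
have nTc : ~ T c by move=> ?; apply: cP; left; right.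
have pic : pi c = c by case: (pselect (pi c = c)) => // ?; case: cP; right.
have tx : act (swap a c) x = x.
  by apply: Tx => d Td; apply: swapD => dE; [apply: nTa|apply: nTc]; rewrite -dE.
have : act (swap a c * pi * swap a c) x = x.
  apply: Sx => d Sd; rewrite !fpM; case: (pselect (d = a)) => [->|da].
    by rewrite swapL pic swapR.
  have dc : d <> c by move=> dc; apply: nSc; rewrite -dc.
  by rewrite swapD// piS ?swapD//; split.
rewrite !actM tx => e; apply: (act_inj (pi := swap a c)).
by rewrite e tx.
Qed.

Lemma supp_supports x : finitely_supported x -> supports (supp x) x.
Proof.
case=> S Sf Sx.
have H (s : seq At) : supports (S `\` ([set` s] `\` supp x)) x.
  elim: s => [|a s IH].
    rewrite (_ : S `\` _ = S)//; apply/seteqP; split=> c; first by case.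
    by move=> Sc; split=> //= -[].
  case: (pselect (supp x a)) => xa.
    move=> pi piS; apply: IH => c [Sc cP]; apply: piS; split=> // -[/= cas ncx].
    by apply: cP; split=> //=; move: cas; rewrite inE => /predU1P[cE|//]; subst c.
  have [T [Tf Tx] nTa] : exists2 T, finite_set T /\ supports T x & ~ T a.
    by move: xa; rewrite /supp => /existsNP[T /not_implyP[? ?]]; exists T.
  move=> pi piS.
  apply: (@supports_setD1 x _ T _ Tf IH Tx a nTa) => //.
    exact: finite_setD.
  move=> c [[Sc cP] /= ca]; apply: piS; split=> // -[/= + ncx].
  by rewrite inE => /predU1P[//|cs]; apply: cP.
have [s SE] := (finite_seqP _).1 Sf.
move=> pi piS; apply: (H s) => c [Sc cP]; apply: piS.
by apply: contrapT => ncx; apply: cP; split=> //; rewrite -SE.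
Qed.

Lemma supp_least x : finitely_supported x ->
  [/\ finite_set (supp x), supports (supp x) x &
      forall S, finite_set S -> supports S x -> supp x `<=` S].
Proof.
move=> xf; split; [exact: supp_finite|exact: supp_supports|].
by move=> S; exact: supp_sub.
Qed.

Lemma supp_fix x pi : finitely_supported x -> fixes pi (supp x) -> act pi x = x.
Proof. by move=> xf; exact: supp_supports. Qed.
End SuppTheory.

Record nomSet (At : countType) := NomSet {
  nom_ps :> permSet At;
  nom_fs : forall x : nom_ps, finitely_supported x }.

Record eqMap (At : countType) (X Y : permSet At) := EqMap {
  eqm_fun :> X -> Y;
  eqmE : forall (pi : finPerm At) x, eqm_fun (act pi x) = act pi (eqm_fun x) }.

Section Nom.
Variable At : countType.
Implicit Types X Y Z : nomSet At.

Lemma eqMapP (X Y : permSet At) (f g : eqMap X Y) : f =1 g -> f = g.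
Proof.
case: f g => [f fE] [g gE] /= /funext fg; subst g.
by congr EqMap; exact: Prop_irrelevance.
Qed.

Lemma supports_eqm (X Y : permSet At) (f : eqMap X Y) S x :
  supports S x -> supports S (f x).
Proof. by move=> Sx pi piS; rewrite -eqmE Sx. Qed.

Lemma supp_eqm (X Y : permSet At) (f : eqMap X Y) x : supp (f x) `<=` supp x.
Proof.
by move=> a fxa S [Sf Sx]; apply: fxa; split=> //; exact: supports_eqm.
Qed.

Definition eqm_id X : eqMap X X := @EqMap At X X id (fun _ _ => erefl).

Lemma eqm_comp_subproof X Y Z (g : eqMap Y Z) (f : eqMap X Y)
  (pi : finPerm At) x : (g \o f) (act pi x) = act pi ((g \o f) x).
Proof. by rewrite /= !eqmE. Qed.

Definition eqm_comp X Y Z (g : eqMap Y Z) (f : eqMap X Y) : eqMap X Z :=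
  EqMap (eqm_comp_subproof g f).

Definition Nom : category.
Proof.
refine (@Category (nomSet At) (fun X Y => eqMap X Y) eqm_id eqm_comp _ _ _).
- by move=> X Y u; exact: eqMapP.
- by move=> X Y u; exact: eqMapP.
- by move=> X Y Z T w v u; exact: eqMapP.
Defined.

Section SubPermSet.
Variables (X : permSet At) (P : X -> Prop).
Hypothesis P_act : forall (pi : finPerm At) x, P x -> P (act pi x).

Definition sub_act (pi : finPerm At) (x : {x | P x}) : {x | P x} :=
  exist P (act pi (sval x)) (P_act pi (svalP x)).

Definition subPermSet : permSet At.
Proof.
refine (@PermSet At {x | P x} sub_act _ _).
- by case=> x Px; apply: eq_exist => /=; exact: act1.
- by move=> pi sg [x Px]; apply: eq_exist => /=; exact: actM.
Defined.

Lemma supports_sub (S : set At) (x : subPermSet) :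
  supports S x <-> supports S (sval x).
Proof.
case: x => x Px; split=> Sx pi /Sx; first by case.
by move=> e; apply: eq_exist.
Qed.

Lemma supp_subE (x : subPermSet) : supp x = supp (sval x).
Proof.
by apply/seteqP; split=> a xa S [Sf Sx]; apply: xa; split=> //; exact/supports_sub.
Qed.

Lemma finitely_supported_sub (x : subPermSet) :
  finitely_supported (sval x) -> finitely_supported x.
Proof. by case=> S Sf Sx; exists S => //; exact/supports_sub. Qed.
End SubPermSet.

Section Prod.
Variables X Y : permSet At.

Definition prodPermSet : permSet At.
Proof.
refine (@PermSet At (X * Y) (fun pi xy => (act pi xy.1, act pi xy.2)) _ _).
- by case=> x y; rewrite !act1.
- by move=> pi sg [x y]; rewrite !actM.
Defined.

Lemma finitely_supported_prod (xy : prodPermSet) :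
  finitely_supported xy.1 -> finitely_supported xy.2 -> finitely_supported xy.
Proof.
case: xy => x y [S Sf Sx] [T Tf Ty]; exists (S `|` T).
  by rewrite finite_setU.
by move=> pi piST; rewrite /= Sx ?Ty// => a ?; apply: piST; [right|left].
Qed.
End Prod.

Section SepPullback.
Variables (A B X : nomSet At) (f : eqMap A X) (g : eqMap B X).

Definition separated (ab : prodPermSet A B) : Prop :=
  f ab.1 = g ab.2 /\ supp ab.1 `&` supp ab.2 = supp (f ab.1).

Lemma separated_act (pi : finPerm At) ab : separated ab -> separated (act pi ab).
Proof.
case: ab => a b [/= fg sE]; split => /=; first by rewrite !eqmE fg.
by rewrite eqmE !supp_act -sE image_fpI.
Qed.

Lemma sepPullback_fs (ab : subPermSet separated_act) : finitely_supported ab.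
Proof.
apply: finitely_supported_sub.
by apply: finitely_supported_prod; exact: nom_fs.
Qed.

Definition sepPullback : nomSet At := NomSet sepPullback_fs.

Definition sepPullback_fst : eqMap sepPullback A.
Proof. by exists (fun ab => (sval ab).1). Defined.

End SepPullback.

Section Nabla.
Variables (E B : nomSet At) (p : eqMap E B).

Definition nabla_ob (g : slice (B : Nom)) : slice (E : Nom) :=
  @SliceOb Nom E (sepPullback p (arr g)) (sepPullback_fst p (arr g)).

Section Map.
Variables (g g' : slice (B : Nom)) (u : Hom g g').

Lemma shom_appE x : arr g' (shom u x) = arr g x :> B.
Proof. by rewrite -(shomE u). Qed.

Lemma nabla_separated ex :
  separated p (arr g) ex -> separated p (arr g') (ex.1, shom u ex.2).
Proof.
case: ex => e x [/= pg sE]; split; rewrite /= ?shom_appE//.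
apply/seteqP; split=> a; first by move=> [ea /supp_eqm xa]; rewrite -sE.
move=> pa; split; first exact: supp_eqm pa.
by move: pa; rewrite pg -shom_appE; exact: supp_eqm.
Qed.

Definition nabla_fun (z : sepPullback p (arr g)) : sepPullback p (arr g') :=
  exist _ ((sval z).1, shom u (sval z).2) (nabla_separated (svalP z)).

Lemma nabla_eqv (pi : finPerm At) z : nabla_fun (act pi z) = act pi (nabla_fun z).
Proof. by apply: eq_exist; rewrite /= eqmE. Qed.

Definition nabla_hom : Hom (nabla_ob g) (nabla_ob g').
Proof.
exists (EqMap nabla_eqv : Hom (_ : Nom) (_ : Nom)); exact: eqMapP.
Defined.
End Map.

Definition nabla : functor (slice (B : Nom)) (slice (E : Nom)).
Proof.
refine (@Functor _ _ nabla_ob nabla_hom _ _).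
- by move=> g; apply: sliceHom_inj; apply: eqMapP => -[[e x] h]; exact: eq_exist.
- move=> g g' g'' v u; apply: sliceHom_inj; apply: eqMapP => -[[e x] h].
  exact: eq_exist.
Defined.
End Nabla.

Section BoxObject.
Variables (E B A : nomSet At) (p : eqMap E B) (f : eqMap A E).

(* A pair (b, s_b); the partial function s_b on the fibre of p over b is encoded
   as a map E -> option A whose domain is contained in that fibre. *)
Record psect := PSect {
  base : B;
  sect : E -> option A;
  sectP : forall e a, sect e = Some a -> p e = base /\ f a = e }.

Lemma psect_inj z z' : base z = base z' -> sect z =1 sect z' -> z = z'.
Proof.
case: z z' => [b s sP] [b' s' s'P] /= bb /funext ss; subst b' s'.
by congr PSect; exact: Prop_irrelevance.
Qed.

Lemma psect_act_subproof (pi : finPerm At) z e a :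
  omap (act pi) (sect z (act pi^-1 e)) = Some a ->
  p e = act pi (base z) /\ f a = e.
Proof.
case ze: (sect z _) => [a'|//] [<-].
have [pe fa] := sectP ze.
by rewrite -pe eqmE actVK eqmE fa actVK.
Qed.

Definition psect_act (pi : finPerm At) z := PSect (@psect_act_subproof pi z).

Definition psectSet : permSet At.
Proof.
refine (@PermSet At psect psect_act _ _).
- move=> z; apply: psect_inj => [|e] /=; first exact: act1.
  by rewrite invg1 act1; case: (sect z e) => //= a; rewrite act1.
- move=> pi sg z; apply: psect_inj => [|e] /=; first exact: actM.
  by rewrite invgM actM; case: (sect z _) => //= a; rewrite actM.
Defined.

Definition pdom (z : psectSet) : set E := [set e | sect z e].
Definition pgraph (z : psectSet) : set (E * A) :=
  [set ea | sect z ea.1 = Some ea.2].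

Definition box_cond (z : psectSet) : Prop :=
  [/\ finitely_supported z,
      pdom z = [set e | p e = base z /\ supp e `&` supp z = supp (base z)] &
      supp z `\` supp (base z)
        = \bigcup_(ea in pgraph z) (supp ea.2 `\` supp ea.1)].

Lemma pgraph_act (pi : finPerm At) (z : psectSet) e a :
  pgraph z (e, a) -> pgraph (act pi z) (act pi e, act pi a).
Proof. by rewrite /pgraph /= actK => ->. Qed.

Lemma pgraph_actV (pi : finPerm At) (z : psectSet) e a :
  pgraph (act pi z) (e, a) -> pgraph z (act pi^-1 e, act pi^-1 a).
Proof. by move=> /(pgraph_act pi^-1); rewrite actK. Qed.

Lemma pdomP (z : psectSet) e : pdom z e <-> exists a, pgraph z (e, a).
Proof.
rewrite /pdom /pgraph /=; case: (sect z e) => [a|]; split=> //.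
  by exists a.
by case.
Qed.

Lemma pdom_act (pi : finPerm At) (z : psectSet) e :
  pdom z e -> pdom (act pi z) (act pi e).
Proof. by move=> /pdomP[a ea]; apply/pdomP; exists (act pi a); exact: pgraph_act. Qed.

Lemma box_cond_act (pi : finPerm At) z : box_cond z -> box_cond (act pi z).
Proof.
have img (rho : finPerm At) (e : E) (w : psectSet) : p e = base w ->
    supp e `&` supp w = supp (base w) ->
    p (act rho e) = base (act rho w) /\
    supp (act rho e) `&` supp (act rho w) = supp (base (act rho w)).
  by move=> pe sE; rewrite eqmE pe /= !supp_act -image_fpI sE.
case=> zf zdom zsupp; split; first exact: finitely_supported_act.
- apply/seteqP; split=> [e /pdomP[a /pgraph_actV ea]|e [pe sE]].
    have : pdom z (act pi^-1 e) by apply/pdomP; exists (act pi^-1 a).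
    rewrite zdom => -[pe sE]; have := img pi _ _ pe sE.
    by rewrite actVK.
  have : pdom z (act pi^-1 e).
    by rewrite zdom; have := img pi^-1 _ _ pe sE; rewrite actK.
  by move/(pdom_act pi); rewrite actVK.
- rewrite /= !supp_act; apply/seteqP; split=> [_ [[c zc <-] nb]|c].
    have : (supp z `\` supp (base z)) c.
      by split=> // bc; apply: nb; exists c.
    rewrite zsupp => -[[e a] ea [/= ac nec]].
    exists (act pi e, act pi a); first exact: pgraph_act.
    split; rewrite /= supp_act; first by exists c.
    by case=> d ed /fp_inj dc; apply: nec; rewrite -dc.
  case=> -[e a] /pgraph_actV ea [/= ac nec].
  have : (supp z `\` supp (base z)) ((pi^-1)%g c).
    rewrite zsupp; exists (act pi^-1 e, act pi^-1 a) => //.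
    split; rewrite /= supp_act; first by exists c.
    by case=> d ed /fp_inj dc; apply: nec; rewrite -dc.
  case=> zc nb; split; first by exists ((pi^-1)%g c) => //; exact: fpVK.
  by case=> d bd dc; apply: nb; rewrite -dc fpK.
Qed.

Lemma box_fs (z : subPermSet box_cond_act) : finitely_supported z.
Proof. by apply: finitely_supported_sub; case: (svalP z). Qed.

Definition box : nomSet At := NomSet box_fs.

Lemma box_inj (z z' : box) : sval z = sval z' -> z = z'.
Proof. by case: z z' => [z zP] [z' z'P]; exact: eq_exist. Qed.

Definition box_base : eqMap box B.
Proof. by exists (fun z => base (sval z)). Defined.

Lemma supp_base (z : psectSet) : supp (base z) `<=` supp z.
Proof.
by move=> a ba S [Sf Sz]; apply: ba; split=> // pi piS; rewrite -{2}(Sz pi piS).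
Qed.

Lemma base_supp_sub (z : psectSet) e : p e = base z -> supp (base z) `<=` supp e.
Proof. by move=> <-; exact: supp_eqm. Qed.

Lemma sepE (z : psectSet) e S : p e = base z -> supp (base z) `<=` S ->
  (supp e `&` S = supp (base z)) <->
  (forall a, supp e a -> S a -> supp (base z) a).
Proof.
move=> pe bS; split=> [<- //|H]; apply/seteqP; split=> a; first by case=> ? ?; exact: H.
by move=> ba; split; [exact: base_supp_sub pe _ ba|exact: bS].
Qed.

Hypothesis At_inf : infinite_set [set: At].

Lemma box_rename (z : psectSet) e S T : p e = base z ->
  supp (base z) `<=` S -> finite_set S -> finite_set T ->
  (forall a, supp e a -> S a -> supp (base z) a) ->
  exists pi : finPerm At, [/\ fixes pi S, p (act pi e) = base z &
    forall a, supp (act pi e) a -> S a \/ T a -> supp (base z) a].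
Proof.
move=> pe bS Sf Tf eS.
have [s sE] := (finite_seqP _).1 (supp_finite (nom_fs e)).
have STf : finite_set (S `|` T) by rewrite finite_setU.
have [pi [piS piT]] := finPerm_rename At_inf s Sf STf.
exists pi; split=> //.
  rewrite eqmE pe; apply: supp_fix => //; first exact: nom_fs.
  by move=> a /bS; exact: piS.
move=> a; rewrite supp_act => -[d ed <-] ST.
case: (pselect (S d)) => [Sd|nSd]; first by rewrite piS//; exact: eS.
by exfalso; apply: (piT d) => //; move: ed; rewrite sE.
Qed.

Lemma box_rename_dom (z : box) e S T : p e = base (sval z) ->
  supp (base (sval z)) `<=` S -> finite_set S -> finite_set T ->
  (forall a, supp e a -> S a -> supp (base (sval z)) a) ->
  exists pi : finPerm At, [/\ fixes pi S, pdom (sval z) (act pi e) &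
    forall a, supp (act pi e) a -> S a \/ T a -> supp (base (sval z)) a].
Proof.
move=> pe bS Sf Tf eS; have [zf zd _] := svalP z.
have Wf : finite_set (T `|` supp (sval z)).
  by rewrite finite_setU; split=> //; exact: supp_finite.
have [pi [piS ppe piST]] := box_rename pe bS Sf Wf eS.
exists pi; split=> //; last by move=> a ea [|]; move=> ?; apply: piST => //; [left|right; left].
rewrite zd; split=> //; apply/sepE => //; first exact: supp_base.
by move=> a ea za; apply: piST => //; right; right.
Qed.

Lemma box_sect_supp (z : box) e a : pgraph (sval z) (e, a) ->
  supp a `<=` supp e `|` supp (sval z).
Proof.
move=> ea c ac; case: (pselect (supp e c)) => [|nec]; [by left|right].
have [_ _ zs] := svalP z.
suff: (supp (sval z) `\` supp (base (sval z))) c by case.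
by rewrite zs; exists (e, a).
Qed.

Lemma pgraph_fun (z : psectSet) e a a' : pgraph z (e, a) -> pgraph z (e, a') -> a = a'.
Proof. by rewrite /pgraph /= => -> []. Qed.

Lemma pgraph_fix (z : box) (pi : finPerm At) e a : fixes pi (supp (sval z)) ->
  pgraph (sval z) (e, a) -> pgraph (sval z) (act pi e, act pi a).
Proof.
move=> pz /(pgraph_act pi); rewrite supp_fix//.
by case: (svalP z).
Qed.

(* An element of the product is determined by its values on the arguments e
   that are fresh, relative to its base point, for a finite set W. *)
Lemma box_agree (z z' : box) W : finite_set W ->
  base (sval z) = base (sval z') ->
  (forall e a a', (forall c, supp e c -> W c -> supp (base (sval z)) c) ->
     pgraph (sval z) (e, a) -> pgraph (sval z') (e, a') -> a = a') ->
  z = z'.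
Proof.
have half (y y' : box) : finite_set W -> base (sval y) = base (sval y') ->
    (forall e a a', (forall c, supp e c -> W c -> supp (base (sval y)) c) ->
     pgraph (sval y) (e, a) -> pgraph (sval y') (e, a') -> a = a') ->
    supp (sval y) `<=` supp (sval y').
  move=> Wf bb agree c yc.
  have [yf yd ys] := svalP y; have [y'f y'd y's] := svalP y'.
  case: (pselect (supp (base (sval y)) c)) => [|nbc].
    by rewrite bb; exact: supp_base.
  have : (supp (sval y) `\` supp (base (sval y))) c by [].
  rewrite ys => -[[e a] ea [/= ac nec]].
  have [pe fa] := sectP ea.
  have eS d : supp e d -> supp (sval y) d -> supp (base (sval y)) d.
    have : pdom (sval y) e by apply/pdomP; exists a.
    by rewrite yd => -[_ <-].
  have W'f : finite_set (W `|` supp (sval y')).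
    by rewrite finite_setU; split=> //; exact: supp_finite.
  have [pi [piS _ piST]] :=
    box_rename_dom pe (@supp_base _) (supp_finite yf) W'f eS.
  have ya := pgraph_fix piS ea.
  have [ppe _] := sectP ya.
  have /pdomP[a' ya'] : pdom (sval y') (act pi e).
    rewrite y'd; split; first by rewrite ppe.
    apply/sepE; [by rewrite ppe|exact: supp_base|].
    by move=> d ed y'd'; rewrite -bb; apply: piST => //; right; right.
  have aa : act pi a = a'.
    by apply: agree ya ya' => d ed Wd; apply: piST => //; right; left.
  subst a'.
  have := @box_sect_supp y' _ _ ya' c.
  have pc : pi c = c by apply: piS.
  case; rewrite ?supp_act//; first by exists c.
  by case=> d ed dc; exfalso; apply: nec; rewrite -pc in dc; rewrite -(fp_inj dc).
move=> Wf bb agree.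
have ss : supp (sval z) = supp (sval z').
  apply/seteqP; split; first exact: half.
  apply: half => // e a a' eW za z'a.
  by symmetry; apply: agree za => // c ec Wc; rewrite bb; exact: eW.
have [zf zd zs] := svalP z; have [z'f z'd z's] := svalP z'.
have dd : pdom (sval z) = pdom (sval z') by rewrite zd z'd ss bb.
have zz e a : pgraph (sval z) (e, a) -> pgraph (sval z') (e, a).
  move=> ea; have [pe _] := sectP ea.
  have de : pdom (sval z) e by apply/pdomP; exists a.
  have /pdomP[a' ea'] : pdom (sval z') e by rewrite -dd.
  have eS d : supp e d -> supp (sval z) d -> supp (base (sval z)) d.
    by move: de; rewrite zd => -[_ <-].
  have [pi [piS _ piST]] :=
    box_rename_dom pe (@supp_base _) (supp_finite zf) Wf eS.
  have : act pi a = act pi a'.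
    apply: agree (pgraph_fix piS ea) (pgraph_fix _ ea').
      by move=> d ed Wd; apply: piST => //; right.
    by rewrite -ss.
  by move/act_inj => ->.
apply: box_inj; apply: psect_inj => // e.
case ze: (sect (sval z) e) => [a|]; first by rewrite (zz e a).
case z'e: (sect (sval z') e) => [a'|//].
have : pdom (sval z') e by rewrite /pdom /= z'e.
by rewrite -dd /pdom /= ze.
Qed.
End BoxObject.

Lemma act_agree (X : nomSet At) (pi sg : finPerm At) (x : X) :
  infinite_set [set: At] ->
  (forall a, supp x a -> pi a = sg a) -> act pi x = act sg x.
Proof.
move=> At_inf ps; apply: (act_inj (pi := sg^-1)); rewrite actK -actM.
apply: supp_fix => //; first exact: nom_fs.
by move=> a /ps pa; rewrite fpM pa fpK.
Qed.

Lemma psect_supp (E B A : nomSet At) (p : eqMap E B) (f : eqMap A E)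
  (z : psectSet p f) e a :
  infinite_set [set: At] -> finitely_supported z ->
  pgraph z (e, a) -> supp a `<=` supp e `|` supp z.
Proof.
move=> At_inf zf ea; apply: supp_sub.
  by rewrite finite_setU; split; apply: supp_finite => //; exact: nom_fs.
move=> pi piS; have := pgraph_act pi ea.
rewrite supp_fix//; last by move=> c zc; apply: piS; right.
rewrite supp_fix//; [|exact: nom_fs|by move=> c ec; apply: piS; left].
by move=> /pgraph_fun - /(_ _ ea).
Qed.

Section BoxMap.
Hypothesis At_inf : infinite_set [set: At].
Variables (E B : nomSet At) (p : eqMap E B).
Variables (A A' : nomSet At) (f : eqMap A E) (f' : eqMap A' E) (u : eqMap A A').

(* The domain of the section underlying z' may be strictly larger than that of z,
   because z' may have a smaller support. *)
Definition box_ext (z : box p f) (z' : box p f') : Prop :=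
  base (sval z') = base (sval z) /\
  forall e a, sect (sval z) e = Some a -> sect (sval z') e = Some (u a).

Lemma box_ext_uniq z z1 z2 : box_ext z z1 -> box_ext z z2 -> z1 = z2.
Proof.
move=> [b1 e1] [b2 e2]; have [zf zd _] := svalP z.
apply: (box_agree At_inf (supp_finite zf)); first by rewrite b1.
move=> e a1 a2; rewrite b1 => eW z1e z2e.
have [pe _] := sectP z1e; rewrite b1 in pe.
have /pdomP[a za] : pdom (sval z) e.
  by rewrite zd; split=> //; apply/sepE => //; exact: supp_base.
by move: z1e z2e; rewrite /pgraph /= (e1 _ _ za) (e2 _ _ za) => -[<-] [].
Qed.

Hypothesis uE : forall a, f' (u a) = f a.

Section Extension.
Variable z : box p f.
Let W := supp (sval z).
Let b := base (sval z).
Let S : set At :=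
  supp b `|` \bigcup_(ea in pgraph (sval z)) (supp (u ea.2) `\` supp ea.1).
Let G e a' := exists pi a,
  [/\ fixes pi S, pgraph (sval z) (act pi e, a) & act pi a' = u a].

Let W_fin : finite_set W.
Proof. by apply: supp_finite; case: (svalP z). Qed.

Let SW : S `<=` W.
Proof.
move=> c [|[[e a] ea [/= /supp_eqm ac nec]]]; first exact: supp_base.
by have [] := box_sect_supp ea ac.
Qed.

Let S_fin : finite_set S. Proof. exact: sub_finite_set SW W_fin. Qed.

Let bS : supp b `<=` S. Proof. by move=> c; left. Qed.

Let fixb pi : fixes pi S -> act pi b = b.
Proof. by move=> h; apply: supp_fix => //; [exact: nom_fs|move=> c /bS /h]. Qed.

Let dom_sep e a : pgraph (sval z) (e, a) ->
  forall c, supp e c -> W c -> supp b c.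
Proof.
move=> ea; have : pdom (sval z) e by apply/pdomP; exists a.
by have [_ -> _] := svalP z => -[_]; rewrite -/W -/b => <-.
Qed.

Let suppS e a : pgraph (sval z) (e, a) -> supp (u a) `<=` supp e `|` S.
Proof.
move=> ea c uc; case: (pselect (supp e c)) => nec; [by left|right; right].
by exists (e, a).
Qed.

Let G_fun e a1 a2 : G e a1 -> G e a2 -> a1 = a2.
Proof.
move=> [pi1 [c1 [pS1 g1 E1]]] [pi2 [c2 [pS2 g2 E2]]].
set e1 := act pi1 e in g1; set e2 := act pi2 e in g2.
pose sg := pi2 * pi1^-1.
have sgS : fixes sg S by apply: fixesM => //; exact: fixesV.
have sge : act sg e1 = e2 by rewrite /sg actM actK.
pose h c := if pselect (W c) then c else sg c.
have Wef : finite_set (W `|` supp e1).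
  by rewrite finite_setU; split=> //; apply: supp_finite; exact: nom_fs.
have [s sE] := (finite_seqP _).1 Wef.
have mixed x y : supp e1 y -> W x -> ~ W y -> x <> sg y.
  move=> ey Wx nWy xy; apply: nWy.
  have bx : supp b x.
    by apply: (dom_sep g2) => //; rewrite -sge supp_act; exists y.
  have : sg x = sg y by rewrite sgS//; exact: bS.
  by move/fp_inj <-.
have hinj : {in s &, injective h}.
  have es x : x \in s -> W x \/ supp e1 x.
    by move=> xs; have : [set` s] x by []; rewrite -sE.
  move=> x y /es xs /es ys; rewrite /h.
  case: pselect => Wx; case: pselect => Wy //.
  - by case: ys => // ey /(mixed _ _ ey Wx Wy).
  - by case: xs => // ex /esym /(mixed _ _ ex Wy Wx).
  - exact: fp_inj.
have [tau tauE] := finPerm_extend hinj.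
have tauh c : W c \/ supp e1 c -> tau c = h c.
  by move=> cP; apply: tauE; have : [set` s] c by rewrite -sE.
have tauW : fixes tau W.
  by move=> c Wc; rewrite tauh /h; [case: pselect|left].
have taue c : supp e1 c -> tau c = sg c.
  move=> ec; rewrite tauh /h; last by right.
  by case: pselect => // Wc; rewrite sgS//; apply: bS; exact: dom_sep g1 _ ec Wc.
have tau12 : act tau e1 = e2 by rewrite -sge; exact: act_agree.
have := pgraph_fix At_inf tauW g1; rewrite tau12 => /pgraph_fun - /(_ _ g2) c12.
have : act tau (u c1) = act sg (u c1).
  apply: act_agree => // c /(suppS g1)[|Sc]; first exact: taue.
  by rewrite tauW ?sgS//; exact: SW.
rewrite -eqmE c12 -E2 -E1 /sg actM actK.
by move/act_inj.
Qed.

Let G_act rho e a' : fixes rho S -> G e a' -> G (act rho e) (act rho a').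
Proof.
move=> rS [pi [a [pS g e']]]; exists (pi * rho^-1), a; split.
- by apply: fixesM => //; exact: fixesV.
- by rewrite actM actK.
- by rewrite actM actK.
Qed.

Let G_sec e a' : G e a' -> p e = b /\ f' a' = e.
Proof.
move=> [pi [a [pS g e']]]; have [pe fa] := sectP g; split.
  by apply: (act_inj (pi := pi)); rewrite fixb// -eqmE.
by apply: (act_inj (pi := pi)); rewrite -eqmE e' uE.
Qed.

Let sf e : option A' :=
  if pselect (exists a', G e a') is left h then Some (sval (cid h)) else None.

Let sfP e a' : sf e = Some a' <-> G e a'.
Proof.
rewrite /sf; case: pselect => [h|h]; last by split=> // g; case: h; exists a'.
case: cid => a'' /= g; split=> [[<-//]|g']; congr Some; exact: G_fun g g'.
Qed.

Let sf_sec e a' : sf e = Some a' -> p e = b /\ f' a' = e.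
Proof. by move/sfP/G_sec. Qed.

Let z' : psectSet p f' := PSect sf_sec.

Let z'P e a' : pgraph z' (e, a') <-> G e a'. Proof. exact: sfP. Qed.

Let G_ext e a : pgraph (sval z) (e, a) -> G e (u a).
Proof. by exists 1, a; rewrite !act1. Qed.

Let z'_supports : supports S z'.
Proof.
move=> pi pS; apply: psect_inj => [|e]; first exact: fixb.
have HG a : pgraph (act pi z') (e, a) <-> pgraph z' (e, a).
  split=> [/pgraph_actV/z'P/(G_act pS)|/z'P/(G_act (fixesV pS))/z'P].
    by rewrite !actVK => /z'P.
  by move/(pgraph_act pi); rewrite !actVK.
case z1: (sect z' e) => [a|]; first exact: (HG a).2.
case z2: (sect (act pi z') e) => [a|//].
by rewrite -z1; symmetry; exact: (HG a).1.
Qed.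

Let z'_fs : finitely_supported z'. Proof. by exists S. Qed.

Let z'_supp : supp z' = S.
Proof.
apply/seteqP; split; first exact: supp_sub.
move=> c [bc|[[e a] /= ea [uc nec]]]; first exact: (@supp_base _ _ _ _ _ z').
by have [|] := psect_supp At_inf z'_fs ((z'P _ _).2 (G_ext ea)) uc.
Qed.

Let z'_box : box_cond z'.
Proof.
split=> //; rewrite z'_supp -[base z']/b.
- apply/seteqP; split=> [e /pdomP[a' /z'P g]|e [pe eS]].
    have [pe _] := G_sec g; split=> //; apply/(@sepE _ _ _ _ _ z') => //.
    case: g => pi [a [pS g _]] c ec Sc.
    apply: (dom_sep g); last exact: SW.
    by rewrite supp_act; exists c => //; exact: pS.
  have [pi [pS /pdomP[a ea] _]] := box_rename_dom At_inf pe bS S_fin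
    (finite_set0 _) ((sepE pe bS).1 eS).
  apply/pdomP; exists (act pi^-1 (u a)); apply/z'P.
  by exists pi, a; rewrite actVK.
- apply/seteqP; split=> [c [[//|[[e a] ea ec]] _]|c].
    by exists (e, u a) => //; apply/z'P; exact: G_ext.
  case=> -[e a'] /z'P g [/= a'c nec]; have [pe _] := G_sec g; split; last first.
    by move=> bc; apply: nec; apply: (@base_supp_sub _ _ _ _ _ (sval z)) bc.
  case: g => pi [a [pS g e']].
  have Spc : S (pi c).
    right; exists (act pi e, a) => //; split=> /=.
      by rewrite -e' supp_act; exists c.
    by rewrite supp_act => -[d ed /fp_inj dc]; apply: nec; rewrite -dc.
  by have := pS _ Spc; move/fp_inj => pc; rewrite pc in Spc.
Qed.

Lemma box_ext_ex : exists z', box_ext z z'.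
Proof.
exists (exist _ z' z'_box); split=> // e a /G_ext; exact: (z'P _ _).2.
Qed.
End Extension.

(* [box_map z] is the unique z' such that [box_ext z z']: the equivariant map over
   B through which u acts on the values of the sections. Mere postcomposition
   with u is not enough, as it may violate the condition on the domain. *)
Definition box_map (z : box p f) : box p f' := sval (cid (box_ext_ex z)).

Lemma box_mapP z : box_ext z (box_map z).
Proof. exact: svalP (cid (box_ext_ex z)). Qed.

Lemma box_map_eqv (pi : finPerm At) z : box_map (act pi z) = act pi (box_map z).
Proof.
apply: box_ext_uniq (box_mapP _) _; have [bE sE] := box_mapP z; split.
  by rewrite /= bE.
move=> e a /=; case ze: (sect _ _) => [a'|//] [<-].
by rewrite (sE _ _ ze) /= eqmE.
Qed.
End BoxMap.

Section Boxtimes.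
Hypothesis At_inf : infinite_set [set: At].
Variables (E B : nomSet At) (p : eqMap E B).

Definition boxtimes_ob (f : slice (E : Nom)) : slice (B : Nom) :=
  @SliceOb Nom B (box p (arr f)) (box_base p (arr f)).

Definition boxtimes_map (f f' : slice (E : Nom)) (u : Hom f f') :
    eqMap (box p (arr f)) (box p (arr f')) :=
  EqMap (box_map_eqv At_inf (p := p) (shom_appE u)).

Definition boxtimes_hom (f f' : slice (E : Nom)) (u : Hom f f') :
  Hom (boxtimes_ob f) (boxtimes_ob f').
Proof.
exists (boxtimes_map u : Hom (_ : Nom) (_ : Nom)).
by apply: eqMapP => z; case: (box_mapP At_inf (shom_appE u) z).
Defined.

Definition boxtimes : functor (slice (E : Nom)) (slice (B : Nom)).
Proof.
refine (@Functor _ _ boxtimes_ob boxtimes_hom _ _).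
- move=> f; apply: sliceHom_inj; apply: eqMapP => z.
  by apply: (box_ext_uniq At_inf (box_mapP At_inf _ z)); split.
- move=> f f' f'' v u; apply: sliceHom_inj; apply: eqMapP => z.
  apply: (box_ext_uniq At_inf (box_mapP At_inf _ z)).
  have [b1 e1] := box_mapP At_inf (shom_appE u) z.
  have [b2 e2] := box_mapP At_inf (shom_appE v)
    (box_map At_inf (shom_appE u) z).
  split; first by rewrite -b1 -b2.
  by move=> e a /e1/e2.
Defined.
End Boxtimes.
End Nom.

(* Main.v *)
Require Import Defs.
From mathcomp Require Import all_boot all_classical.

(** The adjunction is given by its unit and counit. The unit sends [x] over [b]
    to the partial section [e |-> (e, x)], defined on the [e] in the fibre of [b]
    that are separated from [x]. If the fibre is nonempty then, by renaming, it
    contains such an [e], so that the support of the section is that of [x] and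
    conditions (2) and (3) hold; if the fibre is empty, the support is that of
    [b] and both conditions are trivial. The counit sends [(e, (b, s))] to
    [s e], which is defined because condition (2) says that the domain of [s]
    consists of the [e] separated from [(b, s)]. *)

Set Implicit Arguments.
Unset Strict Implicit.
Unset Printing Implicit Defensive.

Local Open Scope classical_set_scope.
Local Open Scope group_scope.

(** Transposition sends [h] to [G h] after [eta], its inverse sends [k] to [eps] after [F k]. Each
    cancellation is one naturality square followed by one triangle identity. *)
Lemma right_adjoint_unit_counit (C D : category) (G : functor D C)
    (F : functor C D) (eta : forall X : C, Hom X (G (F X)))
    (eps : forall Y : D, Hom (F (G Y)) Y) :
  (forall (X X' : C) (u : Hom X' X),
     Defs.comp (fhom G (fhom F u)) (eta X') = Defs.comp (eta X) u) ->
  (forall (Y Y' : D) (v : Hom Y Y'),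
     Defs.comp (eps Y') (fhom F (fhom G v)) = Defs.comp v (eps Y)) ->
  (forall X : C, Defs.comp (eps (F X)) (fhom F (eta X)) = idm (F X)) ->
  (forall Y : D, Defs.comp (fhom G (eps Y)) (eta (G Y)) = idm (G Y)) ->
  right_adjoint G F.
Proof.
move=> eta_nat eps_nat FeK GeK.
exists (fun X Y h => Defs.comp (fhom G h) (eta X)); split=> [X Y|X X' Y Y' u v h].
  exists (fun k => Defs.comp (eps Y) (fhom F k)) => [h|k].
    by rewrite fhom_comp Defs.compA eps_nat -Defs.compA FeK Defs.comp_idr.
  by rewrite fhom_comp -Defs.compA eta_nat Defs.compA GeK Defs.comp_idl.
by rewrite !fhom_comp -!Defs.compA eta_nat.
Qed.

Section Unit.
Variables (At : countType) (At_inf : infinite_set [set: At]).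
Variables (E B X : nomSet At) (p : eqMap E B) (g : eqMap X B).

Let sepfst := sepPullback_fst p g.

Definition sepPullback_snd : eqMap (sepPullback p g) X :=
  @EqMap At (sepPullback p g) X (fun w => (sval w).2) (fun _ _ => erefl).

Definition unit_sect (x : X) (e : E) : option (sepPullback p g) :=
  if pselect (separated p g (e, x)) is left h then Some (exist _ (e, x) h)
  else None.

Lemma unit_sectP x e w :
  unit_sect x e = Some w <-> sval w = (e, x).
Proof.
rewrite /unit_sect; case: pselect => [h|h]; split=> //.
- by move=> [<-].
- by case: w => w wP /= wE; congr Some; exact: eq_exist.
- by move=> wE; case: h; rewrite -wE; exact: (svalP w).
Qed.

Lemma unit_sect_sec x e w : unit_sect x e = Some w -> p e = g x /\ sepfst w = e.
Proof.
by move/unit_sectP; case: w => -[e' x'] /= [pe _] [<- <-].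
Qed.

Definition unit_psect (x : X) : psectSet p sepfst := PSect (@unit_sect_sec x).

Lemma unit_psect_act (pi : finPerm At) x :
  unit_psect (act pi x) = act pi (unit_psect x).
Proof.
apply: psect_inj => [|e] /=; first exact: eqmE.
case xe: (unit_sect x _) => [w|] /=.
  by move/unit_sectP: xe => wE; apply/unit_sectP; rewrite /= wE /= actVK.
case pxe: (unit_sect _ e) => [w|//].
have : unit_sect x (act pi^-1 e) = Some (act pi^-1 w).
  by move/unit_sectP: pxe => wE; apply/unit_sectP; rewrite /= wE /= actK.
by rewrite xe.
Qed.

Lemma supports_unit_psect x : supports (supp x) (unit_psect x).
Proof.
by move=> pi pix; rewrite -unit_psect_act supp_fix//; exact: nom_fs.
Qed.

Lemma unit_psect_fs x : finitely_supported (unit_psect x).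
Proof.
by exists (supp x); [apply: supp_finite; exact: nom_fs|exact: supports_unit_psect].
Qed.

(** Rename the atoms of [e] outside [supp (g x)] away from [supp x]: a permutation fixing
    [supp (g x)] fixes [g x], so [e] stays in its fibre. *)
Lemma unit_dom_ex x e : p e = g x -> exists e', separated p g (e', x).
Proof.
move=> pe.
have xf : finite_set (supp x) by apply: supp_finite; exact: nom_fs.
have bx : supp (g x) `<=` supp x by exact: supp_eqm.
have bf : finite_set (supp (g x)) by exact: sub_finite_set bx xf.
(* Here [S] is [supp (g x)] and [T] is [supp x]. The separation premise reads [S a -> S a], hence
   [id]; [unit_psect x] only supplies the base point [g x]. *)
have [pi [_ ppe pix]] := box_rename At_inf (z := unit_psect x) pe
  (@subset_refl _ _) bf xf (fun _ _ => id).
exists (act pi e); split=> //=; rewrite ppe.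
by apply/(@sepE _ _ _ _ _ _ (unit_psect x)) => // a ea xa; apply: pix => //; right.
Qed.

(** One inclusion is equivariance of [unit_psect]. For the other, take [e'] in the domain: an atom
    of [x] is an atom of the value [(e', x)], so it belongs to the section or to [e'], and in the
    latter case to [supp e' & supp x = supp (g x)]. *)
Lemma supp_unit_psect x e : p e = g x -> supp (unit_psect x) = supp x.
Proof.
move=> /unit_dom_ex[e' h]; apply/seteqP; split.
  by apply: supp_sub; [apply: supp_finite; exact: nom_fs|exact: supports_unit_psect].
move=> c xc; have [/= pe' sE] := h.
have ze' : pgraph (unit_psect x) (e', exist _ (e', x) h) by apply/unit_sectP.
have : supp (exist _ (e', x) h : sepPullback p g) c.
  exact: (@supp_eqm _ _ _ sepPullback_snd (exist _ (e', x) h)).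
case/(psect_supp At_inf (unit_psect_fs x) ze') => // e'c.
by apply: supp_base; rewrite /= -pe' -sE.
Qed.

Lemma unit_box_cond x : box_cond (unit_psect x).
Proof.
split; first exact: unit_psect_fs.
- apply/seteqP; split=> e.
    move=> /pdomP[w /unit_sectP wE]; have := svalP w; rewrite wE => -[/= pe sE].
    by split=> //; rewrite (supp_unit_psect pe) sE pe.
  move=> [pe]; rewrite (supp_unit_psect pe) => sE.
  have h : separated p g (e, x) by split=> //; rewrite sE pe.
  by apply/pdomP; exists (exist _ (e, x) h); apply/unit_sectP.
- apply/seteqP; split=> [c [zc nbc]|c [[e w] ew [/= wc nec]]]; last first.
    have [//|zc] := psect_supp At_inf (unit_psect_fs x) ew wc.
    split=> // bc; apply: nec.
    by apply: (@base_supp_sub _ _ _ _ _ _ (unit_psect x)) bc; have [] := sectP ew.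
  (* Over an empty fibre the section is nowhere defined, hence supported by [supp (g x)],
     contradicting [nbc]. *)
  have [e pe] : exists e, p e = g x.
    apply: contrapT => nE; apply: nbc; move: c zc; apply: supp_sub.
      by apply: supp_finite; exact: nom_fs.
    move=> pi pib; have bpi : act pi (g x) = g x by apply: supp_fix => //; exact: nom_fs.
    apply: psect_inj => [//|e].
    case z1: (sect _ e) => [w|].
      by have [pe _] := sectP z1; case: nE; exists e; rewrite pe.
    case z2: (sect _ e) => [w|//].
    by have [pe _] := sectP z2; case: nE; exists e; rewrite pe.
  (* Any [e'] separated from [x] witnesses condition (3): [c] is in [supp x], so it cannot be in
     [supp e'] without being in [supp (g x)]. *)
  have [e' h] := unit_dom_ex pe; have [/= pe' sE] := h.
  have ze' : pgraph (unit_psect x) (e', exist _ (e', x) h) by apply/unit_sectP.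
  exists (e', exist _ (e', x) h) => //=; split; last first.
    move=> e'c; apply: nbc; rewrite /= -pe' -sE; split=> //=.
    by rewrite -(supp_unit_psect pe).
  apply: (@supp_eqm _ _ _ sepPullback_snd (exist _ (e', x) h)) => /=.
  by rewrite -(supp_unit_psect pe).
Qed.

Definition unit_box (x : X) : box p sepfst := exist _ _ (unit_box_cond x).

Lemma unit_box_act (pi : finPerm At) x : unit_box (act pi x) = act pi (unit_box x).
Proof. by apply: box_inj; exact: unit_psect_act. Qed.
End Unit.

Section Counit.
Variables (At : countType) (E B A : nomSet At) (p : eqMap E B) (f : eqMap A E).

Lemma counit_ex (w : sepPullback p (box_base p f)) :
  exists a, pgraph (sval (sval w).2) ((sval w).1, a).
Proof.
case: w => -[e z] [/= pe sE]; apply/pdomP.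
(* Separatedness refers to the support of [z] in [box], condition (2) to that of the underlying
   section; [supp_subE] identifies the two. *)
by have [_ -> _] := svalP z; split=> //; rewrite -supp_subE sE pe.
Qed.

Definition counit (w : sepPullback p (box_base p f)) : A := sval (cid (counit_ex w)).

Lemma counitP w : sect (sval (sval w).2) (sval w).1 = Some (counit w).
Proof. exact: svalP (cid (counit_ex w)). Qed.

Lemma counit_unique w a : sect (sval (sval w).2) (sval w).1 = Some a -> counit w = a.
Proof. by rewrite counitP => -[]. Qed.

Lemma counit_act (pi : finPerm At) w : counit (act pi w) = act pi (counit w).
Proof.
apply: counit_unique.
by apply: (@pgraph_act _ _ _ _ _ _ _ (sval (sval w).2)); exact: counitP.
Qed.

Lemma counit_sec w : f (counit w) = (sval w).1.
Proof. by have [] := sectP (counitP w). Qed.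
End Counit.

Section Adjunction.
Variables (At : countType) (At_inf : infinite_set [set: At]).
Variables (E B : nomSet At) (p : eqMap E B).

Definition box_unit (g : slice (B : Nom At)) :
  Hom g (boxtimes At_inf p (nabla p g)).
Proof.
exists (EqMap (unit_box_act At_inf p (arr g)) : Hom (_ : Nom At) (_ : Nom At)).
exact: eqMapP.
Defined.

Definition box_counit (f : slice (E : Nom At)) :
  Hom (nabla p (boxtimes At_inf p f)) f.
Proof.
exists (EqMap (counit_act (p := p) (f := arr f)) : Hom (_ : Nom At) (_ : Nom At)).
by apply: eqMapP => w; exact: counit_sec.
Defined.

(** The action of [boxtimes] on maps is the unique extension of postcomposition, so it suffices that
    the unit section at [u x] extends the image of the one at [x]: what is separated from [x] is
    separated from [u x]. *)
Lemma box_unit_natural (g g' : slice (B : Nom At)) (u : Hom g' g) :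
  Defs.comp (fhom (boxtimes At_inf p) (fhom (nabla p) u)) (box_unit g')
  = Defs.comp (box_unit g) u.
Proof.
apply: sliceHom_inj; apply: eqMapP => x.
apply: (box_ext_uniq At_inf (box_mapP At_inf _ _)); split.
  exact: shom_appE.
by move=> e w /unit_sectP wE; apply/unit_sectP; rewrite /= wE.
Qed.

(** The counit evaluates only at points of the original domain, where the extended section agrees
    with postcomposition by [v]. *)
Lemma box_counit_natural (f f' : slice (E : Nom At)) (v : Hom f f') :
  Defs.comp (box_counit f') (fhom (nabla p) (fhom (boxtimes At_inf p) v))
  = Defs.comp v (box_counit f).
Proof.
apply: sliceHom_inj; apply: eqMapP => w.
apply: counit_unique.
have [_ extE] := box_mapP At_inf (shom_appE v) (sval w).2.
by apply: extE; exact: counitP.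
Qed.

Lemma box_triangle_nabla (g : slice (B : Nom At)) :
  Defs.comp (box_counit (nabla p g)) (fhom (nabla p) (box_unit g)) = idm (nabla p g).
Proof.
apply: sliceHom_inj; apply: eqMapP => w.
by apply: counit_unique; apply/unit_sectP => /=; case: (sval w).
Qed.

(** By uniqueness of extensions: [z] itself extends the section sending [e] to the counit at
    [(e, z)], which is the value of [z] at [e]. *)
Lemma box_triangle_boxtimes (f : slice (E : Nom At)) :
  Defs.comp (fhom (boxtimes At_inf p) (box_counit f)) (box_unit (boxtimes At_inf p f))
  = idm (boxtimes At_inf p f).
Proof.
apply: sliceHom_inj; apply: eqMapP => z.
apply: (box_ext_uniq At_inf (box_mapP At_inf _ _)); split=> // e w /unit_sectP wE.
by have := counitP w; rewrite wE.
Qed.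
End Adjunction.

Theorem proposition6p0p11 (At : countType) (At_inf : infinite_set [set: At]%classic)
    (E B : Nom At) (p : Hom E B) :
  right_adjoint (boxtimes At_inf p) (nabla p).
Proof.
exact: right_adjoint_unit_counit (@box_unit_natural _ At_inf E B p)
  (@box_counit_natural _ At_inf E B p) (@box_triangle_nabla _ At_inf E B p)
  (@box_triangle_boxtimes _ At_inf E B p).
Qed.
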